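(* For any $\varepsilon>0$ there exists a constant $c_\varepsilon>0$ such that for every integer $n\ge2$ there exists a compact homothetic self-similar set $K\subset\mathbb{R}^n$ with $\dim(K)\ge c_\varepsilon\log n$ and with the property that every angle contained in $K$ lies in the $\varepsilon$-neighborhood of the set $\{0,60^\circ,90^\circ,120^\circ,180^\circ\}$. In particular, for any $\alpha\in(0,180^\circ)\setminus\{60^\circ,90^\circ,120^\circ\}$ there is a constant $c(\alpha)>0$ such that for every $n\ge 2$ there is a compact set in $\mathbb{R}^n$ of Hausdorff dimension $c(\alpha)\log n$ that does not contain the angle $\alpha$; moreover, the set contains no angle from some small neighborhood of $\alpha$.
   Context: A set $A\subset\mathbb{R}^n$ contains the angle $\alpha\in[0,180^\circ]$ if there exist distinct points $x,y,z\in A$ such that the angle between the vectors $y-x$ and $z-x$ is $\alpha$. $\dim$ denotes Hausdorff dimension. A map $f:\mathbb{R}^n\to\mathbb{R}^n$ is a homothety if it is the identity, or if it has exactly one fixed point $O$ and there is a nonzero real number $r$ (the ratio) such that $f(P)-O=r(P-O)$ for every point $P$. A compact homothetic self-similar set is a nonempty compact set $K$ with $K=S_0(K)\cup\dots\cup S_k(K)$ where each $S_i$ is a contracting homothety (ratio of absolute value less than $1$). *)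

(* Defs.v *)
From mathcomp Require Export all_boot all_order all_algebra.
From mathcomp Require Export all_classical all_reals all_analysis.
Export Order.TTheory GRing.Theory Num.Theory.
Export numFieldNormedType.Exports.

Set Implicit Arguments.
Unset Strict Implicit.
Unset Printing Implicit Defensive.

Local Open Scope classical_set_scope.
Local Open Scope ring_scope.

(* The norm `| x | that the library puts on 'rV[R]_n is the sup norm; distances
   and angles below use the Euclidean structure. Both induce the same topology,
   so compactness is the library's [compact]. *)
Definition dotp (R : realType) (n : nat) (u v : 'rV[R]_n) : R :=
  \sum_(i < n) u 0 i * v 0 i.

Definition enorm (R : realType) (n : nat) (u : 'rV[R]_n) : R :=
  Num.sqrt (dotp u u).

(* In radians, with values in [0, pi]; meaningful for nonzero u and v. *)
Definition angle (R : realType) (n : nat) (u v : 'rV[R]_n) : R :=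
  acos (dotp u v / (enorm u * enorm v)).

Definition contains_angle (R : realType) (n : nat) (A : set 'rV[R]_n)
    (alpha : R) : Prop :=
  exists x y z : 'rV[R]_n,
    [/\ A x, A y & A z] /\
    [/\ x <> y, x <> z & y <> z] /\
    angle (y - x) (z - x) = alpha.

(* Equals -oo on the empty set, which is treated separately in [diam_pow]. *)
Definition ediam (R : realType) (n : nat) (U : set 'rV[R]_n) : \bar R :=
  ereal_sup [set (enorm (p.1 - p.2))%:E | p in U `*` U].

(* diam(U)^s with the usual conventions: the empty set contributes 0 for every
   s >= 0, and 0^0 = 1 for a nonempty U of diameter 0. *)
Definition diam_pow (R : realType) (n : nat) (s : R) (U : set 'rV[R]_n)
    : \bar R :=
  if U == set0 then 0%E else poweR (ediam U) s.

Definition delta_cover (R : realType) (n : nat) (delta : R)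
    (A : set 'rV[R]_n) (U : nat -> set 'rV[R]_n) : Prop :=
  A `<=` \bigcup_i U i /\ forall i : nat, (ediam (U i) <= delta%:E)%E.

Definition hausdorff_content (R : realType) (n : nat) (s delta : R)
    (A : set 'rV[R]_n) : \bar R :=
  ereal_inf [set (\sum_(0 <= i <oo) diam_pow s (U i))%E
            | U in delta_cover delta A].

(* The limit as delta decreases to 0 is a supremum, since [hausdorff_content]
   is nonincreasing in delta. *)
Definition hausdorff_measure (R : realType) (n : nat) (s : R)
    (A : set 'rV[R]_n) : \bar R :=
  ereal_sup [set hausdorff_content s delta A | delta in [set d : R | 0 < d]].

Definition hausdorff_dim (R : realType) (n : nat) (A : set 'rV[R]_n)
    : \bar R :=
  ereal_inf [set s%:E | s in
    [set s : R | 0 <= s /\ hausdorff_measure s A = 0%E]].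

(* The identity is given ratio 1. *)
Definition homothety_of_ratio (R : realType) (n : nat)
    (f : 'rV[R]_n -> 'rV[R]_n) (r : R) : Prop :=
  (f = id /\ r = 1) \/
  (r != 0 /\ exists O : 'rV[R]_n,
     (forall P : 'rV[R]_n, f P = P <-> P = O) /\
     (forall P : 'rV[R]_n, f P - O = r *: (P - O))).

Definition contracting_homothety (R : realType) (n : nat)
    (f : 'rV[R]_n -> 'rV[R]_n) : Prop :=
  exists r : R, homothety_of_ratio f r /\ `|r| < 1.

Definition compact_homothetic_self_similar (R : realType) (n : nat)
    (K : set 'rV[R]_n) : Prop :=
  [/\ K !=set0, compact K &
    exists (k : nat) (S : 'I_k.+1 -> 'rV[R]_n -> 'rV[R]_n),
      (forall i : 'I_k.+1, contracting_homothety (S i)) /\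
      K = \bigcup_(i in [set: 'I_k.+1]) (S i @` K)].

(* 0, 60, 90, 120 and 180 degrees, in radians. *)
Definition special_angles (R : realType) : set R :=
  [set a : R | [\/ a = 0, a = pi / 3, a = pi / 2 | a = 2 * pi / 3] \/ a = pi].

(* Main.v *)
Require Import Defs.
From mathcomp Require Import ring lra.

Set Implicit Arguments.
Unset Strict Implicit.
Unset Printing Implicit Defensive.

Local Open Scope classical_set_scope.
Local Open Scope ring_scope.

(** Let [K] be the attractor of the [n] homotheties [x |-> e_i + q x], where the
    [e_i] are the standard basis vectors of [R^n] and [q] is small, depending on
    [eps] only. If two points of [K] share exactly their first [k] digits, then
    their difference is [q ^ k (e_i - e_j + r)] with [i <> j] and [|r| <= 4 q].
    Hence every direction determined by [K] is close, uniformly in [n], to a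
    root [e_i - e_j], and the angles between roots are 0, 60, 90, 120 and 180
    degrees.

    Moreover [dim K = ln n / ln (1 / q)]. The upper bound comes from the covers
    by the [n ^ m] cylinders of order [m]. For the lower bound, reading the
    digits of a point as a base-[n] expansion gives a Hoelder map of exponent
    [ln n / ln (1 / q)] from [K] onto the unit interval, so that covers of [K]
    are turned into covers of the interval and compared with Lebesgue measure. *)

(** * Euclidean geometry of row vectors and stability of angles *)

Section Euclid.
Variables (R : realType) (n : nat).
Implicit Types (u v w : 'rV[R]_n) (a : R).

Lemma dotpC u v : dotp u v = dotp v u.
Proof. by apply: eq_bigr => i _; rewrite mulrC. Qed.

Lemma dotpDl u v w : dotp (u + v) w = dotp u w + dotp v w.
Proof. by rewrite -big_split; apply: eq_bigr => i _ /=; rewrite mxE mulrDl. Qed.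

Lemma dotpZl a u v : dotp (a *: u) v = a * dotp u v.
Proof. by rewrite mulr_sumr; apply: eq_bigr => i _ /=; rewrite mxE mulrA. Qed.

Lemma dotpDr u v w : dotp u (v + w) = dotp u v + dotp u w.
Proof. by rewrite !(dotpC u) dotpDl. Qed.

Lemma dotpZr a u v : dotp u (a *: v) = a * dotp u v.
Proof. by rewrite !(dotpC u) dotpZl. Qed.

Lemma dotpBl u v w : dotp (u - v) w = dotp u w - dotp v w.
Proof. by rewrite -scaleN1r dotpDl dotpZl mulN1r. Qed.

Lemma dotpBr u v w : dotp u (v - w) = dotp u v - dotp u w.
Proof. by rewrite !(dotpC u) dotpBl. Qed.

Lemma dotpp_ge0 u : 0 <= dotp u u.
Proof. by apply: sumr_ge0 => i _; rewrite -expr2 sqr_ge0. Qed.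

Lemma enorm_ge0 u : 0 <= enorm u.
Proof. exact: sqrtr_ge0. Qed.

Lemma enorm_sqr u : enorm u ^+ 2 = dotp u u.
Proof. by rewrite sqr_sqrtr ?dotpp_ge0. Qed.

Lemma enormZ a u : 0 <= a -> enorm (a *: u) = a * enorm u.
Proof.
move=> a0; rewrite /enorm dotpZl dotpZr mulrA -expr2 sqrtrM ?sqr_ge0//.
by rewrite sqrtr_sqr ger0_norm.
Qed.

Lemma coord_le_enorm u i : `|u 0 i| <= enorm u.
Proof.
rewrite -sqrtr_sqr ler_wsqrtr// /dotp (bigD1 i)//= expr2 lerDl.
by apply: sumr_ge0 => j _; rewrite -expr2 sqr_ge0.
Qed.

Lemma enorm_eq0 u : enorm u = 0 -> u = 0.
Proof.
move=> u0; apply/rowP => i; rewrite mxE; apply/eqP; rewrite -normr_le0 -u0.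
exact: coord_le_enorm.
Qed.

(** Cauchy-Schwarz. With [A], [B], [C] the products [u.u], [v.v], [u.v], the vector [B u - C v] has
    squared norm [B (A B - C^2)], and [B] is positive unless [v = 0]. *)
Lemma dotp_sqr_le u v : dotp u v ^+ 2 <= dotp u u * dotp v v.
Proof.
have [v0|vn0] := eqVneq (dotp v v) 0.
  have -> : v = 0 by apply: enorm_eq0; rewrite /enorm v0 sqrtr0.
  by rewrite -(scale0r 0) !dotpZr !mul0r mulr0 expr0n.
have vp : 0 < dotp v v by rewrite lt0r vn0 dotpp_ge0.
have := dotpp_ge0 (dotp v v *: u + (- dotp u v) *: v).
rewrite !(dotpDl, dotpDr, dotpZl, dotpZr) (dotpC v u).
set A := dotp u u; set B := dotp v v; set C := dotp u v.
rewrite [X in 0 <= X](_ : _ = B * (A * B - C ^+ 2)); last by ring.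
by rewrite pmulr_rge0// subr_ge0.
Qed.

Lemma normr_dotp_le u v : `|dotp u v| <= enorm u * enorm v.
Proof.
rewrite -ler_sqr ?nnegrE ?mulr_ge0 ?enorm_ge0// exprMn !enorm_sqr.
by rewrite real_normK ?num_real ?dotp_sqr_le.
Qed.

Lemma enormD u v : enorm (u + v) <= enorm u + enorm v.
Proof.
rewrite -ler_sqr ?nnegrE ?addr_ge0 ?enorm_ge0// enorm_sqr dotpDl !dotpDr.
rewrite (dotpC v u) -!enorm_sqr; have := normr_dotp_le u v.
by have := ler_norm (dotp u v); set A := enorm u; set B := enorm v; lra.
Qed.

Lemma enormN u : enorm (- u) = enorm u.
Proof. by rewrite /enorm -scaleN1r dotpZl dotpZr mulrA mulrNN !mul1r. Qed.

Lemma enormB_ge u v : enorm u - enorm v <= enorm (u + v).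
Proof.
by have := enormD (u + v) (- v); rewrite addrK enormN lerBlDr.
Qed.

(** Squaring the sum only adds nonnegative cross terms. This bounds the attractor by a constant
    independent of [n]. *)
Lemma enorm_le_sum u : (forall i, 0 <= u 0 i) -> enorm u <= \sum_i u 0 i.
Proof.
move=> u0; rewrite -ler_sqr ?nnegrE ?enorm_ge0 ?sumr_ge0// enorm_sqr.
rewrite expr2 mulr_sumr; apply: ler_sum => i _.
rewrite ler_wpM2r// (bigD1 i)//= lerDl; exact: sumr_ge0.
Qed.

(** The scalars cancel in the quotient; if a vector vanishes, both quotients are 0 because the
    inverse of 0 is 0. This removes the powers of [q] from differences of points. *)
Lemma angleZ a b u v : 0 < a -> 0 < b -> angle (a *: u) (b *: v) = angle u v.
Proof.
move=> a0 b0; rewrite /angle dotpZl dotpZr !enormZ ?ltW//; congr acos.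
have [->|u0] := eqVneq (enorm u) 0; first by rewrite !(mulr0, mul0r, invr0).
have [->|v0] := eqVneq (enorm v) 0; first by rewrite !(mulr0, mul0r, invr0).
by field; rewrite u0 v0 !gt_eqF.
Qed.

Lemma cos_angle u v : cos (angle u v) = dotp u v / (enorm u * enorm v) /\
  0 <= angle u v <= pi.
Proof.
rewrite /angle; set c := _ / _.
suff c1 : -1 <= c <= 1 by have [? ?] := acos_def c1.
rewrite -ler_norml /c normrM normfV (ger0_norm (mulr_ge0 _ _)) ?enorm_ge0//.
(* For a zero vector the quotient is 0, still in the domain of [acos]. *)
have [->|P0] := eqVneq (enorm u * enorm v) 0; first by rewrite invr0 mulr0.
rewrite ler_pdivrMr ?mul1r ?normr_dotp_le//.
by rewrite lt0r P0 mulr_ge0 ?enorm_ge0.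
Qed.

(** Here [a] and [b] stand for roots, of norm [sqrt 2], and [u], [v] for small errors. Numerator and
    denominator of the cosine each move by at most [4 * h], by Cauchy-Schwarz and the triangle
    inequality, so the bound is linear in [h] and free of [n]. *)
Lemma cos_angle_perturb (h : R) (a b : 'rV[R]_n) u v :
  dotp a a = 2 -> dotp b b = 2 -> enorm u <= h -> enorm v <= h -> h <= 4^-1 / 4 ->
  `|cos (angle (a + u) (b + v)) - dotp a b / 2| <= 8 * h.
Proof.
move=> aa bb uh vh h1; rewrite (cos_angle _ _).1.
(* [3 / 2] is a rational upper bound for [sqrt 2]; it gives [3 * h + h ^+ 2 <= 4 * h] in the
   estimates below. *)
have sq2 (c : 'rV[R]_n) : dotp c c = 2 -> 0 <= enorm c <= 3 / 2.
  by move=> cc; have := enorm_sqr c; have := enorm_ge0 c; rewrite cc; nra.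
have := sq2 _ aa; have := sq2 _ bb; have := enorm_sqr a; have := enorm_sqr b.
have := enormB_ge a u; have := enormD a u.
have := enormB_ge b v; have := enormD b v.
have := normr_dotp_le a v; have := normr_dotp_le u b; have := normr_dotp_le u v.
have := normr_dotp_le a b.
rewrite dotpDl !dotpDr aa bb.
have := enorm_ge0 u; have := enorm_ge0 v.
move: uh vh (enorm_ge0 (a + u)) (enorm_ge0 (b + v)).
set A := enorm a; set B := enorm b; set U := enorm u; set V := enorm v.
set P := enorm (a + u); set Q := enorm (b + v).
set ab := dotp a b; set av := dotp a v; set ub := dotp u b; set uv := dotp u v.
move=> Uh Vh P0 Q0 V0 U0 /[!ler_norml] /andP[ab1 ab2] /andP[uv1 uv2].
move=> /andP[ub1 ub2] /andP[av1 av2] Q2 Q1 P2 P1 BB AA /andP[B0 B1] /andP[A0 A1].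
have AB : A * B = 2.
  have : (A * B) ^+ 2 = 2 ^+ 2 by rewrite exprMn AA BB expr2.
  by move/eqP; rewrite eqrXn2 ?mulr_ge0// => /eqP.
have PQ1 : 2 - 4 * h <= P * Q by nra.
have PQ2 : P * Q <= 2 + 4 * h by nra.
have N1 : - (4 * h) <= av + (ub + uv) by nra.
have N2 : av + (ub + uv) <= 4 * h by nra.
have PQ : 1 <= P * Q by lra.
(* The new numerator is at most [16 * h] in absolute value, as [|ab| <= 2], and the denominator is
   at least 2. *)
have -> : (ab + av + (ub + uv)) / (P * Q) - ab / 2 =
  (2 * (av + (ub + uv)) - ab * (P * Q - 2)) / (2 * (P * Q)).
  by field; apply/andP; split; apply/eqP => PQ0; move: PQ; rewrite PQ0; nra.
rewrite ler_pdivrMr ?ler_pdivlMr; [|lra..].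
move: (P * Q) PQ PQ1 PQ2 => X X0 X1 X2; apply/andP; split; nra.
Qed.

End Euclid.

(** * Cosines of the special angles, and recovering an angle from its cosine *)

Section SpecialAngles.
Variable R : realType.

Lemma cos_pi_third : cos (pi / 3) = 2^-1 :> R.
Proof.
have pi0 := pi_gt0 R.
have c0 : 0 < cos (pi / 3 : R) by apply: cos_gt0_pihalf; lra.
(* Both sides are the cosine of [2 * pi / 3]. With [c] the cosine of [pi / 3] this reads
   [- c = 2 * c ^+ 2 - 1], whose only positive root is [2^-1]. *)
have : cos (pi - pi / 3 : R) = cos (pi / 3 + pi / 3) by congr cos; field.
rewrite addrC cosDpi cosN cosD -!expr2.
move: c0 (cos2Dsin2 (pi / 3 : R)); set c := cos _; set s := sin _ => c0 cs e.
have : (c - 2^-1) * (c + 1) = 0 by nra.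
by move/eqP; rewrite mulf_eq0 => /orP[] /eqP; lra.
Qed.

Lemma cos_2pi_third : cos (2 * pi / 3) = - 2^-1 :> R.
Proof.
rewrite -cos_pi_third -[in RHS](cosN (pi / 3)) -cosDpi; congr cos.
by field.
Qed.

(** Continuity of the inverse of the cosine at [cos a]: strict monotonicity on [[0, pi]] gives one
    threshold on each side of [a]. Where [a + eps] or [a - eps] leaves the interval, that side holds
    trivially and any threshold does. *)
Lemma cos_near (a eps : R) : 0 <= a <= pi -> 0 < eps ->
  exists2 h, 0 < h & forall t, 0 <= t <= pi -> `|cos t - cos a| < h ->
    `|t - a| < eps.
Proof.
move=> api e0.
have [h1 h10 H1] : exists2 h, 0 < h & forall t, 0 <= t <= pi ->
    `|cos t - cos a| < h -> t < a + eps.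
  have [ae|ae] := ltP pi (a + eps).
    by exists 1 => // t /andP[_ tp] _; exact: le_lt_trans ae.
  exists (cos a - cos (a + eps)).
    by rewrite subr_gt0 ltr_cos ?in_itv/= ?ltrDl//; lra.
  move=> t tpi; rewrite real_ltNge ?num_real// => tc.
  rewrite real_ltNge ?num_real//; apply: contraNN tc => aet.
  rewrite distrC; apply: le_trans (ler_norm _); rewrite lerD2l lerN2.
  rewrite leNgt ltr_cos ?in_itv/=; [by rewrite -leNgt|lra|lra].
have [h2 h20 H2] : exists2 h, 0 < h & forall t, 0 <= t <= pi ->
    `|cos t - cos a| < h -> a - eps < t.
  have [ae|ae] := ltP (a - eps) 0.
    by exists 1 => // t /andP[tp _] _; exact: lt_le_trans tp.
  exists (cos (a - eps) - cos a).
    by rewrite subr_gt0 ltr_cos ?in_itv/= ?ltrBlDr ?ltrDl//; lra.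
  move=> t tpi; rewrite real_ltNge ?num_real// => tc.
  rewrite real_ltNge ?num_real//; apply: contraNN tc => aet.
  apply: le_trans (ler_norm _); rewrite lerD2r.
  rewrite leNgt ltr_cos ?in_itv/=; [by rewrite -leNgt|lra|lra].
exists (Num.min h1 h2); first by rewrite lt_min h10.
move=> t tpi; rewrite lt_min => /andP[/(H1 _ tpi) t1 /(H2 _ tpi) t2].
by rewrite ltr_norml; lra.
Qed.

Lemma special_angle_bounds (a : R) : special_angles a -> 0 <= a <= pi.
Proof. by have pi0 := pi_gt0 R; case=> [[->|->|->|->]|->]; lra. Qed.

(** The five listed values are the cosines of the five special angles; the least of the five
    thresholds serves for all. *)
Lemma special_angles_near (eps : R) : 0 < eps ->
  exists2 h, 0 < h & forall t c, 0 <= t <= pi ->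
    c \in [:: 0; 1; -1; 2^-1; - 2^-1] -> `|cos t - c| < h ->
    exists a, special_angles a /\ `|t - a| < eps.
Proof.
move=> e0.
have s0 : special_angles (0 : R) by left; constructor 1.
have s1 : special_angles (pi / 3 : R) by left; constructor 2.
have s2 : special_angles (pi / 2 : R) by left; constructor 3.
have s3 : special_angles (2 * pi / 3 : R) by left; constructor 4.
have s4 : special_angles (pi : R) by right.
have [h0 h00 H0] := cos_near (special_angle_bounds s0) e0.
have [h1 h10 H1] := cos_near (special_angle_bounds s1) e0.
have [h2 h20 H2] := cos_near (special_angle_bounds s2) e0.
have [h3 h30 H3] := cos_near (special_angle_bounds s3) e0.
have [h4 h40 H4] := cos_near (special_angle_bounds s4) e0.
exists (Num.min h0 (Num.min h1 (Num.min h2 (Num.min h3 h4)))).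
  by rewrite !lt_min h00 h10 h20 h30.
move=> t c tpi; rewrite !lt_min !inE => cs /and5P[l0 l1 l2 l3 l4].
case/or4P: cs => [/eqP ec|/eqP ec|/eqP ec|/orP[] /eqP ec]; subst c.
- by exists (pi / 2); split=> //; apply: H2 => //; rewrite cos_pihalf.
- by exists 0; split=> //; apply: H0 => //; rewrite cos0.
- by exists pi; split=> //; apply: H4 => //; rewrite cospi.
- by exists (pi / 3); split=> //; apply: H1 => //; rewrite cos_pi_third.
- by exists (2 * pi / 3); split=> //; apply: H3 => //; rewrite cos_2pi_third.
Qed.

End SpecialAngles.

(** * The attractor, its digits and its directions *)

Definition bvec (R : realType) (n : nat) (i : 'I_n) : 'rV[R]_n := delta_mx 0 i.

Definition simil (R : realType) (n : nat) (q : R) (i : 'I_n) (x : 'rV[R]_n)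
    : 'rV[R]_n := bvec R i + q *: x.

(** A simplex that every [simil q i] maps into itself, since [1 + 2 * q <= 2] for the ratios in
    use. *)
Definition corner (R : realType) (n : nat) : set 'rV[R]_n :=
  [set x | (forall j, 0 <= x 0 j) /\ \sum_j x 0 j <= 2].

(** Level [m] is the union of the images of [corner] under the words of [m] homotheties. Each image
    is written as a preimage under the inverse map, so that closedness passes to the next level by
    continuity. *)
Fixpoint attractor_level (R : realType) (n : nat) (q : R) (m : nat)
    : set 'rV[R]_n :=
  if m is m'.+1 then
    \bigcup_(i in [set: 'I_n])
      [set x | attractor_level q m' (q^-1 *: (x - bvec R i))]
  else @corner R n.

Definition attractor (R : realType) (n : nat) (q : R) : set 'rV[R]_n :=
  \bigcap_m attractor_level q m.
Arguments attractor {R} n q.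

Section Attractor.
Variables (R : realType) (n : nat) (q : R).
Hypotheses (q0 : 0 < q) (q1 : q <= 4^-1).
Implicit Types (x y : 'rV[R]_n) (i j : 'I_n) (m : nat).
Local Notation level := (@attractor_level R n q).
Local Notation K := (attractor n q).
Local Notation S := (@simil R n q).

Let qn0 : q != 0. Proof. by rewrite gt_eqF. Qed.

Lemma bvecE i j : bvec R i 0 j = (j == i)%:R.
Proof. by rewrite mxE eqxx. Qed.

Lemma dotp_bvec i j : dotp (bvec R i) (bvec R j) = (i == j)%:R.
Proof.
rewrite /dotp (bigD1 i)//= big1 ?addr0 => [|k /negPf ki]; rewrite !bvecE.
  by rewrite eqxx mul1r.
by rewrite ki mul0r.
Qed.

Lemma similK i x : q^-1 *: (S i x - bvec R i) = x.
Proof. by rewrite /simil addrC addKr scalerA mulVf// scale1r. Qed.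

Lemma simil_inv i x : S i (q^-1 *: (x - bvec R i)) = x.
Proof. by rewrite /simil scalerA mulfV// scale1r addrC subrK. Qed.

Lemma similE i x j : S i x 0 j = (j == i)%:R + q * x 0 j.
Proof. by rewrite mxE bvecE mxE. Qed.

Lemma similB i x y : S i x - S i y = q *: (x - y).
Proof. by rewrite /simil opprD addrACA subrr add0r scalerBr. Qed.

Lemma corner_coord x j : @corner R n x -> 0 <= x 0 j <= 2.
Proof.
case=> x0 x2; rewrite x0; apply: le_trans x2; rewrite (bigD1 j)//= lerDl.
by apply: sumr_ge0.
Qed.

Lemma simil_corner i x : @corner R n x -> @corner R n (S i x).
Proof.
move=> [x0 x2]; split=> [j|].
  by rewrite similE addr_ge0// mulr_ge0// ltW.
under eq_bigr do rewrite similE.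
rewrite big_split/= -mulr_sumr (bigD1 i)//= eqxx big1 ?addr0; last first.
  by move=> j /negPf ->.
have : q * \sum_j x 0 j <= q * 2 by rewrite ler_pM2l.
by rewrite mulr1n; move: q1; lra.
Qed.

Lemma levelS m x : level m.+1 x <-> exists i y, level m y /\ x = S i y.
Proof.
split=> [[i _ /= xi]|[i [y [ym ->]]]].
  by exists i, (q^-1 *: (x - bvec R i)); rewrite simil_inv.
by exists i => //=; rewrite similK.
Qed.

Lemma level_corner m : level m `<=` @corner R n.
Proof.
elim: m => [//|m IH] x /levelS[i [y [/IH ym ->]]]; exact: simil_corner.
Qed.

Lemma attractor_corner : K `<=` @corner R n.
Proof. by move=> x /(_ 0%N I). Qed.

(** Coordinate [i] is at least 1 on the piece with digit [i] and at most [2 * q <= 2^-1] on every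
    other piece. The pieces are thus uniformly separated, and first digits are well defined. *)
Lemma simil_coord_gap i j x y : @corner R n x -> @corner R n y -> i != j ->
  2^-1 <= S i x 0 i - S j y 0 i.
Proof.
move=> /(corner_coord i) xi /(corner_coord i) yi ij.
have : 0 <= q * x 0 i by apply: mulr_ge0; [exact: ltW|lra].
have : q * y 0 i <= q * 2 by rewrite ler_pM2l//; lra.
by rewrite !similE eqxx (negPf ij) mulr1n mulr0n; move: q1; lra.
Qed.

Lemma simil_digit_inj i j x y : @corner R n x -> @corner R n y ->
  S i x = S j y -> i = j.
Proof.
move=> xc yc e; apply/eqP; apply: contraT => ij.
by have := simil_coord_gap xc yc ij; rewrite e subrr; lra.
Qed.

Lemma attractor_simil i x : K x -> K (S i x).
Proof.
move=> xK [_|m _]; first exact/simil_corner/attractor_corner.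
by apply/levelS; exists i, x; split=> //; exact: xK.
Qed.

(** Level 1 provides a first digit and a preimage [y]. Each deeper level provides its own digit, but
    digits are unique, so the same [y] lies in every level. *)
Lemma attractorP x : K x -> exists i y, K y /\ x = S i y.
Proof.
move=> xK; have /levelS[i [y [y0 xy]]] : level 1 x by exact: xK.
exists i, y; split=> // m _.
have /levelS[j [z [zm xz]]] : level m.+1 x by exact: xK.
have ij : i = j.
  apply: (@simil_digit_inj i j y z) => //; last by rewrite -xy.
  exact: level_corner zm.
by rewrite -(similK i y) -xy xz ij similK.
Qed.

Lemma enorm_attractorB x y : K x -> K y -> enorm (y - x) <= 4.
Proof.
have K2 z : K z -> enorm z <= 2.
  by move=> /attractor_corner[z0 z2]; exact: le_trans (enorm_le_sum z0) z2.
move=> /K2 xK /K2 yK; apply: le_trans (enormD _ _) _.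
by rewrite enormN; lra.
Qed.

Lemma exprq_lt (e : R) : 0 < e -> exists m, q ^+ m < e.
Proof.
move=> e0; have qa : `|q| < 1 by rewrite gtr0_norm//; move: q1; lra.
have /cvgrPdist_lt/(_ e e0)[m _ /(_ m (leqnn m))/=] := cvg_expr qa.
by rewrite sub0r normrN gtr0_norm ?exprn_gt0//; exists m.
Qed.

(** Common leading digits are stripped until the first disagreement; [k] is the number of digits
    removed. *)
Lemma attractor_direction x y : K x -> K y -> x <> y ->
  exists k i j x' y', [/\ i != j, K x', K y' &
    y - x = q ^+ k *: ((bvec R i - bvec R j) + q *: (y' - x'))].
Proof.
move=> xK yK xy.
have e0 : 0 < enorm (y - x) / 4.
  rewrite divr_gt0// lt0r enorm_ge0 andbT; apply/eqP => /enorm_eq0/eqP.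
  by rewrite subr_eq0 => /eqP yx; apply: xy.
have [m] := exprq_lt e0; rewrite ltr_pdivlMr//.
(* Induction on [m] with [q ^+ m * 4] below the distance: removing a common digit divides the
   distance by [q]. At [m = 0] the distance would exceed 4, the bound on the diameter. *)
elim: m x y xK yK {xy e0} => [|m IH] x y xK yK.
  by rewrite expr0 mul1r ltNge enorm_attractorB.
have [j [x' [xK' ex]]] := attractorP xK.
have [i [y' [yK' ey]]] := attractorP yK.
have [ij|ij] := eqVneq i j.
  rewrite ex ey ij similB enormZ ?ltW// exprS -mulrA ltr_pM2l// => /(IH _ _ xK' yK').
  move=> [k [i' [j' [x'' [y'' [? ? ? ->]]]]]].
  by exists k.+1, i', j', x'', y''; split=> //; rewrite scalerA -exprS.
move=> _; exists 0%N, i, j, x', y'; split=> //.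
by rewrite ex ey scale1r /simil opprD addrACA scalerBr.
Qed.

(** Roots have squared norm 2, so these are the cosines between them. The proof runs through the
    possible coincidences among the four indices. *)
Lemma dotp_roots (i j k l : 'I_n) : i != j -> k != l ->
  dotp (bvec R i - bvec R j) (bvec R k - bvec R l) / 2
    \in [:: 0; 1; -1; 2^-1; - 2^-1].
Proof.
move=> ij kl; rewrite !(dotpBl, dotpBr) !dotp_bvec.
have dis (a c d : 'I_n) : c != d -> ~~ ((a == c) && (a == d)).
  by apply: contraNN => /andP[/eqP <-].
have dis' (a b c : 'I_n) : a != b -> ~~ ((a == c) && (b == c)).
  by apply: contraNN => /andP[/eqP -> /eqP ->].
move: (dis i k l kl) (dis j k l kl) (dis' i j k ij) (dis' i j l ij).
have d2 : (1 + 1) / 2 = 1 :> R by field.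
rewrite !inE.
case: (i == k); case: (i == l); case: (j == k); case: (j == l) => //= _ _ _ _.
all: rewrite ?(mulr1n, mulr0n, subr0, sub0r, opprK, subrr, mul0r, mul1r, eqxx) ?orbT//.
all: by rewrite -?opprD ?mulNr ?d2 ?mul1r eqxx ?orbT.
Qed.

Lemma attractor_angle h x y z : K x -> K y -> K z -> x <> y -> x <> z ->
  q <= 64^-1 / 2 -> 32 * q < h ->
  exists2 c, c \in [:: 0; 1; -1; 2^-1; - 2^-1] &
    `|cos (angle (y - x) (z - x)) - c| < h.
Proof.
move=> xK yK zK xy xz q2 qh.
have [k [i [j [x' [y' [ij xK' yK' ->]]]]]] := attractor_direction xK yK xy.
have [l [a [b [x'' [z' [ab xK'' zK' ->]]]]]] := attractor_direction xK zK xz.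
rewrite angleZ ?exprn_gt0//.
exists (dotp (bvec R i - bvec R j) (bvec R a - bvec R b) / 2).
  exact: dotp_roots.
have root2 (s t : 'I_n) : s != t ->
    dotp (bvec R s - bvec R t) (bvec R s - bvec R t) = 2.
  move=> /negPf st; rewrite !(dotpBl, dotpBr).
  by rewrite !dotp_bvec !eqxx (eq_sym t) st subr0 sub0r opprK -natrD.
(* The errors have norm at most [4 * q], so the cosine is off by at most [32 * q]. *)
apply: le_lt_trans (@cos_angle_perturb _ _ (4 * q) _ _ _ _ _ _ _ _ _) _.
- exact: root2.
- exact: root2.
- by rewrite enormZ ?(ltW q0)// mulrC ler_wpM2r ?(ltW q0)// enorm_attractorB.
- by rewrite enormZ ?(ltW q0)// mulrC ler_wpM2r ?(ltW q0)// enorm_attractorB.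
- lra.
- by lra.
Qed.

End Attractor.

(** * Compactness and self-similarity of the attractor *)

Section SelfSimilar.
Variables (R : realType) (n : nat) (q : R).
Hypotheses (q0 : 0 < q) (q1 : q <= 4^-1).
Local Notation level := (@attractor_level R n q).
Local Notation K := (attractor n q).
Local Notation S := (@simil R n q).

Lemma closed_corner : closed (@corner R n).
Proof.
have -> : @corner R n = (\bigcap_(j in [set: 'I_n]) [set x : 'rV[R]_n | 0 <= x 0 j])
    `&` [set x | \sum_j x 0 j <= 2].
  by apply/seteqP; split=> [x [x0 x2]|x [x0 x2]]; split=> // j *; exact: x0.
apply: closedI.
  apply: closed_bigI => j _.
  apply: (@preimage_closed _ _ (fun x : 'rV[R]_n => x 0 j) [set y | 0 <= y]);
    last exact: closed_ge.
  by move=> x _; exact: coord_continuous.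
apply: (@preimage_closed _ _ (fun x : 'rV[R]_n => \sum_j x 0 j)
  [set y | y <= 2]); last exact: closed_le.
move=> x _; apply: cvg_big; first exact: add_continuous.
  exact: nbhs_filter.
by move=> j _; exact: coord_continuous.
Qed.

Lemma closed_level m : closed (level m).
Proof.
elim: m => [|m IH]; first exact: closed_corner.
apply: closed_bigcup => [|i _]; first exact: finite_finset.
apply: (@preimage_closed _ _ (fun x : 'rV[R]_n => q^-1 *: (x - bvec R i)) (level m)) => // x _.
apply: (@continuous_comp _ _ _ (fun x : 'rV[R]_n => x - bvec R i) (fun x => q^-1 *: x)).
  by apply: (@cvgB _ 'rV[R]_n _ (nbhs x)); [exact: cvg_id|exact: cvg_cst].
exact: scaler_continuous.
Qed.

Lemma compact_attractor : compact K.
Proof.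
apply: bounded_closed_compact.
  exists 2; split=> [|M M2 x /attractor_corner xK]; first exact: num_real.
  apply: le_trans (ltW M2); rewrite [leLHS]mx_normrE.
  apply: bigmax_le => // -[i j] _ /=; rewrite ord1.
  by have /andP[x0 x2] := corner_coord j xK; rewrite ger0_norm.
apply: closed_bigI => m _; exact: closed_level.
Qed.

Lemma simil_contracting i : contracting_homothety (S i).
Proof.
have q1' : 0 < 1 - q by move: q1; lra.
have qn : 1 - q != 0 by rewrite gt_eqF.
exists q; split; last by rewrite gtr0_norm//; move: q1'; lra.
right; split; first by rewrite gt_eqF.
(* The solution of [O = bvec R i + q *: O]. *)
pose O := (1 - q)^-1 *: bvec R i.
have SO P : S i P - O = q *: (P - O).
  by apply/rowP => j; rewrite !mxE eqxx/=; field.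
exists O; split=> // P; split=> [PO|->].
  have /eqP := SO P; rewrite PO -subr_eq0 -[X in X - _]scale1r -scalerBl.
  by rewrite scaler_eq0 (negPf qn) subr_eq0 => /eqP.
by apply/eqP; rewrite -subr_eq0 SO subrr scaler0.
Qed.

(** This gives nonemptiness. The fixed point lies in [corner] because [(1 - q)^-1 <= 2], and being
    its own image under [S i] it then lies in every level. *)
Lemma attractor_fixpoint (i : 'I_n) : K ((1 - q)^-1 *: bvec R i).
Proof.
have q1' : 0 < 1 - q by move: q1; lra.
set O := _ *: _.
have SO : S i O = O.
  apply/rowP => j; rewrite similE !mxE eqxx /=; field; exact: lt0r_neq0.
move=> m _; elim: m => [|m IH]; last by apply/levelS => //; exists i, O.
split=> [j|]; first by rewrite !mxE mulr_ge0 ?ler0n// invr_ge0 ltW.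
under eq_bigr do rewrite mxE bvecE.
rewrite -mulr_sumr (bigD1 i)//= eqxx big1 ?addr0 ?mulr1.
  by rewrite invf_ple ?posrE//; move: q1; lra.
by move=> j /negPf ->.
Qed.

Lemma attractor_self_similar : (0 < n)%N -> compact_homothetic_self_similar K.
Proof.
move=> n0; pose i0 : 'I_n := Ordinal n0; split.
  by eexists; exact: (attractor_fixpoint i0).
  exact: compact_attractor.
(* Self-similarity is stated with [k.+1] maps, so the [n] homotheties are reindexed by a cast. *)
have nE : n.-1.+1 = n by rewrite prednK.
exists n.-1, (fun i => S (cast_ord nE i)); split=> [i|].
  exact: simil_contracting.
apply/seteqP; split=> [x|x [i _ [y yK <-]]]; last exact: attractor_simil.
move=> /(attractorP q0 q1)[i [y [yK ->]]]; exists (cast_ord (esym nE) i) => //.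
by exists y => //; rewrite cast_ordKV.
Qed.

End SelfSimilar.

(** * Diameters and Hausdorff content *)

Section Diameter.
Variables (R : realType) (n : nat).
Implicit Types (U : set 'rV[R]_n) (s : R).

Lemma ediam_le U (D : R) : (forall x y, U x -> U y -> enorm (x - y) <= D) ->
  (ediam U <= D%:E)%E.
Proof.
move=> UD; apply: ge_ereal_sup => _ [[x y] /= [Ux Uy] <-].
by rewrite lee_fin UD.
Qed.

Lemma enorm_le_ediam U x y : U x -> U y -> ((enorm (x - y))%:E <= ediam U)%E.
Proof. by move=> Ux Uy; apply: ereal_sup_ubound; exists (x, y). Qed.

Lemma diam_pow_ge0 s U : (0 <= diam_pow s U)%E.
Proof. by rewrite /diam_pow; case: ifP => // _; exact: poweR_ge0. Qed.

Lemma diam_pow_set0 s : diam_pow s (set0 : set 'rV[R]_n) = 0%E.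
Proof. by rewrite /diam_pow eqxx. Qed.

Lemma diam_pow_le s U (D : R) : 0 <= s -> 0 <= D -> (ediam U <= D%:E)%E ->
  (diam_pow s U <= (D `^ s)%:E)%E.
Proof.
move=> s0 D0 UD; rewrite /diam_pow; case: ifPn => [_|/set0P[x Ux]].
  by rewrite lee_fin powR_ge0.
rewrite -poweR_EFin gt0_ler_poweR// in_itv/= ?leey ?andbT ?lee_fin//.
apply: le_trans (enorm_le_ediam Ux Ux); by rewrite lee_fin enorm_ge0.
Qed.

Lemma hausdorff_content_ge0 s d (A : set 'rV[R]_n) :
  (0 <= hausdorff_content s d A)%E.
Proof.
apply: le_ereal_inf_tmp => _ [U _ <-].
by apply: nneseries_ge0 => i _ _; exact: diam_pow_ge0.
Qed.

End Diameter.

(** * Upper bound for the dimension by cylinder covers *)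

Section UpperBound.
Variables (R : realType) (n : nat) (q : R).
Hypotheses (q0 : 0 < q) (q1 : q <= 4^-1) (n0 : (0 < n)%N).
Local Notation K := (attractor n q).
Local Notation S := (@simil R n q).
Implicit Types s d : R.

(* The word of length [m] indexed by [i < n ^ m] is read off the base-[n]
   digits of [i]. *)
Lemma attractor_cover m : exists U : nat -> set 'rV[R]_n,
  [/\ K `<=` \bigcup_i U i, forall i, (n ^ m <= i)%N -> U i = set0 &
      forall i x y, U i x -> U i y -> enorm (x - y) <= 4 * q ^+ m].
Proof.
elim: m => [|m [U [KU U0 Ud]]].
  exists (fun i => if i == 0%N then K else set0).
  split=> [x xK|[]//|[|i]//= x y ? ?].
    by exists 0%N.
  by rewrite expr0 mulr1; exact: (@enorm_attractorB _ _ q).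
exists (fun i => S (Ordinal (ltn_pmod i n0)) @` U (i %/ n)%N); split.
- move=> x /(attractorP q0 q1)[j [y [/KU[i _ Uy] ->]]].
  exists (i * n + j)%N => //; exists y.
    by rewrite divnMDl// divn_small ?addn0.
  congr simil; apply: val_inj => /=; by rewrite modnMDl modn_small.
- move=> i ni; rewrite U0 ?image_set0//.
  by rewrite leq_divRL// -expnSr.
- move=> i _ _ [x Ux <-] [y Uy <-]; rewrite similB enormZ ?(ltW q0)// exprS.
  by rewrite mulrCA ler_pM2l//; exact: Ud Ux Uy.
Qed.

Lemma hausdorff_content_attractor_le s d m : 0 <= s -> 4 * q ^+ m <= d ->
  (hausdorff_content s d K <= (4 `^ s * (n%:R * q `^ s) ^+ m)%:E)%E.
Proof.
move=> s0 qd; have [U [KU U0 Ud]] := attractor_cover m.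
have D0 : 0 <= 4 * q ^+ m by rewrite mulr_ge0// exprn_ge0// ltW.
have Ue i : (ediam (U i) <= (4 * q ^+ m)%:E)%E by apply: ediam_le; exact: Ud.
apply: (@le_trans _ _ (\sum_(0 <= i <oo) diam_pow s (U i))%E).
  apply: ereal_inf_lbound; exists U => //; split=> // i.
  by apply: le_trans (Ue i) _; rewrite lee_fin.
(* The sets from index [n ^ m] on are empty and contribute 0, even for [s = 0], by the convention in
   [diam_pow]. *)
rewrite (nneseries_split 0 (n ^ m)%N); last by move=> *; exact: diam_pow_ge0.
rewrite eseries0 ?adde0; last first.
  by move=> i; rewrite add0n => ni _; rewrite U0// diam_pow_set0.
rewrite add0n; apply: (@le_trans _ _ (\sum_(0 <= i < n ^ m) ((4 * q ^+ m) `^ s)%:E)%E).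
  by apply: lee_sum => i _; exact: diam_pow_le.
rewrite big_const_nat subn0 -big_const_ord sumEFin lee_fin.
have qms : (q ^+ m) `^ s = (q `^ s) ^+ m.
  rewrite -(@powR_mulrn _ q)// -?powRrM 1?mulrC ?powRrM ?powR_mulrn ?powR_ge0//.
  exact: ltW.
rewrite sumr_const card_ord powRM ?exprn_ge0 ?(ltW q0)// qms.
by rewrite exprMn -[leLHS]mulr_natl natrX mulrCA.
Qed.

(** For each scale [d] the order of the cylinders can be taken arbitrarily large, and the bound on
    the content decays geometrically in that order. *)
Lemma hausdorff_measure_attractor_eq0 s : 0 <= s -> n%:R * q `^ s < 1 ->
  hausdorff_measure s K = 0%E.
Proof.
move=> s0 z1; set z := n%:R * q `^ s in z1.
have z0 : 0 <= z by rewrite mulr_ge0// powR_ge0.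
suff c0 d : 0 < d -> hausdorff_content s d K = 0%E.
  rewrite /hausdorff_measure (_ : [set _ | _ in _] = [set 0%E]) ?ereal_sup1//.
  apply/seteqP; split=> [_ [d /= d0 <-]|_ ->]; first exact: c0.
  by exists 1; [exact: ltr01|exact: c0].
move=> d0; apply/eqP; rewrite eq_le hausdorff_content_ge0 andbT.
apply/lee_addgt0Pr => e e0; rewrite add0e.
have F0 : 0 < 4 `^ s :> R by exact: powR_gt0.
have zc : `|z| < 1 by rewrite ger0_norm.
have qc : `|q| < 1 by rewrite gtr0_norm//; move: q1; lra.
have /cvgrPdist_lt/(_ (e / 4 `^ s) (divr_gt0 e0 F0)) [N1 _ H1] := cvg_expr zc.
have /cvgrPdist_lt/(_ (d / 4) (divr_gt0 d0 (ltr0Sn _ 3))) [N2 _ H2] := cvg_expr qc.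
(* [N1] brings the bound on the content below [e], and [N2] makes the cylinders fit the scale
   [d]. *)
pose m := maxn N1 N2.
have := H1 m (leq_maxl _ _); have := H2 m (leq_maxr _ _) => /=.
rewrite !sub0r !normrN !ger0_norm ?exprn_ge0 ?(ltW q0)//.
rewrite !ltr_pdivlMr// => qm zm.
apply: le_trans (@hausdorff_content_attractor_le s d m s0 _) _.
  by rewrite mulrC ltW.
by rewrite lee_fin mulrC ltW.
Qed.

End UpperBound.

(** * Lower bound for the dimension by base-[n] coding *)

Definition digit (R : realType) (n : nat) (t : R) : nat := Num.trunc (n%:R * t).

Definition digit_shift (R : realType) (n : nat) (t : R) : R :=
  n%:R * t - (digit n t)%:R.

(** Coordinate [j] of the point truncated to [m] digits: the sum of [q ^+ k] over the positions
    [k < m] at which the digit of [t] is [j]. *)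
Fixpoint coding_approx (R : realType) (n : nat) (q : R) (j m : nat) (t : R)
    : R :=
  if m is m'.+1 then
    (j == digit n t)%:R + q * coding_approx n q j m' (digit_shift n t)
  else 0.

(* The point of the attractor whose sequence of digits is the base-[n]
   expansion of [t]. *)
Definition coding (R : realType) (n : nat) (q : R) (t : R) : 'rV[R]_n :=
  \row_(j < n) limn (fun m => coding_approx n q j m t).

Section LowerBound.
Variables (R : realType) (n : nat) (q : R).
Hypotheses (q0 : 0 < q) (q1 : q <= 4^-1) (n2 : (2 <= n)%N).
Local Notation K := (attractor n q).
Local Notation S := (@simil R n q).
Local Notation T := (@digit_shift R n).
Local Notation Y := (@coding_approx R n q).
Implicit Types s t u : R.

Let n0 : (0 < n)%N. Proof. exact: leq_trans n2. Qed.
Let nR0 : 0 < n%:R :> R. Proof. by rewrite ltr0n. Qed.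

Lemma digit_lt t : 0 <= t < 1 -> (digit n t < n)%N.
Proof.
move=> /andP[t0 t1].
have nt0 : 0 <= n%:R * t by rewrite mulr_ge0.
have /andP[dt _] := truncn_itv nt0.
rewrite -(ltr_nat R); apply: le_lt_trans dt _.
by rewrite gtr_pMr.
Qed.

Lemma digit_shift_itv t : 0 <= t < 1 -> 0 <= T t < 1.
Proof.
move=> /andP[t0 t1].
have nt0 : 0 <= n%:R * t by rewrite mulr_ge0.
have /andP[dt dt'] := truncn_itv nt0.
by rewrite subr_ge0 dt/= ltrBlDl natr1.
Qed.

Lemma coding_approx_bounds j m t : 0 <= Y j m t <= 2.
Proof.
elim: m t => [|m IH] t /=; first by rewrite lexx ler0n.
have /andP[y0 y2] := IH (T t).
have qy0 : 0 <= q * Y j m (T t) by rewrite mulr_ge0// ltW.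
have qy2 : q * Y j m (T t) <= q * 2 by rewrite ler_pM2l.
by move: q1; case: (_ == _); rewrite ?mulr1n ?mulr0n; lra.
Qed.

Lemma coding_approx_nondecreasing j t :
  nondecreasing_seq (fun m => Y j m t).
Proof.
apply/nondecreasing_seqP => m; elim: m t => [|m IH] t.
  by have /andP[] := coding_approx_bounds j 1 t.
by rewrite /= lerD2l ler_pM2l//; exact: IH.
Qed.

Lemma is_cvg_coding_approx j t : cvgn (fun m => Y j m t).
Proof.
apply: nondecreasing_is_cvgn; first exact: coding_approx_nondecreasing.
by exists 2 => _ [m _ <-]; have /andP[] := coding_approx_bounds j m t.
Qed.

Lemma coding_cvg (j : 'I_n) t : (fun m => Y j m t) @ \oo --> coding n q t 0 j.
Proof. by rewrite mxE; exact: is_cvg_coding_approx. Qed.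

(** Passing to the limit in the recursion of [coding_approx]: dropping the first digit of [t] undoes
    one homothety. *)
Lemma codingE t (t01 : 0 <= t < 1) :
  coding n q t = S (Ordinal (digit_lt t01)) (coding n q (T t)).
Proof.
apply/rowP => j; rewrite similE.
have c2 : (fun m => Y j m.+1 t) @ \oo -->
    (j == digit n t :> nat)%:R + q * coding n q (T t) 0 j.
  apply: cvgD; first exact: cvg_cst.
  by apply: cvgM; [exact: cvg_cst|exact: coding_cvg].
have c1 : (fun m => Y j m.+1 t) @ \oo --> coding n q t 0 j.
  by rewrite (cvg_shiftS (fun m => Y j m t)); exact: coding_cvg.
exact: cvg_unique c1 c2.
Qed.

Lemma coding_corner t : 0 <= t < 1 -> @corner R n (coding n q t).
Proof.
move=> t01; split=> [j|].
  rewrite mxE; apply: limr_ge; first exact: is_cvg_coding_approx.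
  by apply: nearW => m; have /andP[] := coding_approx_bounds j m t.
(* At each finite stage exactly one coordinate receives the digit contribution 1, so the sum stays
   below [1 + 2 * q]; the bound then passes to the limit. *)
have sumY m u : 0 <= u < 1 -> \sum_(j < n) Y j m u <= 2.
  elim: m u => [|m IH] u u01 /=; first by rewrite big1 ?ler0n.
  have := IH _ (digit_shift_itv u01); rewrite -(ler_pM2l q0) => IHu.
  rewrite big_split/= -mulr_sumr (bigD1 (Ordinal (digit_lt u01)))//= eqxx.
  rewrite big1 ?addr0; last first.
    by move=> j; rewrite -val_eqE/= => /negPf ->.
  by move: q1; rewrite mulr1n; lra.
have c : (fun m => \sum_(j < n) Y j m t) @ \oo --> \sum_j coding n q t 0 j.
  apply: cvg_big => [|j _]; first exact: add_continuous.
  exact: coding_cvg.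
rewrite -(cvg_lim _ c)//; apply: limr_le; first exact: cvgP c.
by apply: nearW => m; exact: sumY.
Qed.

Lemma coding_attractor t : 0 <= t < 1 -> K (coding n q t).
Proof.
move=> t01 m _; elim: m t t01 => [|m IH] t t01; first exact: coding_corner.
apply/levelS => //; exists (Ordinal (digit_lt t01)), (coding n q (T t)).
by split; [exact/IH/digit_shift_itv|exact: codingE].
Qed.

(** Hoelder continuity of the inverse of [coding], up to an error for digits beyond the [m]-th. If
    the first digits agree, removing them multiplies [t - u] by [n] and divides [D] by [q], and the
    condition on [s] absorbs the change. *)
Lemma coding_holder s m t u (D : R) : 0 <= s -> 1 <= n%:R * q `^ s ->
  0 <= t < 1 -> 0 <= u < 1 -> enorm (coding n q t - coding n q u) <= D ->
  `|t - u| <= (2 * D) `^ s + n%:R ^- m.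
Proof.
move=> s0 ns.
elim: m t u D => [|m IH] t u D t01 u01 tuD.
  rewrite expr0 invr1 -[leLHS]add0r lerD ?powR_ge0// ler_norml.
  by lra.
have D0 : 0 <= D by exact: le_trans (enorm_ge0 _) tuD.
have [dd|dd] := eqVneq (Ordinal (digit_lt t01)) (Ordinal (digit_lt u01)).
  have dd' : digit n t = digit n u by case: dd.
  move: tuD; rewrite (codingE t01) (codingE u01) dd similB enormZ ?(ltW q0)//.
  rewrite -ler_pdivlMl// => tuD.
  have := IH _ _ _ (digit_shift_itv t01) (digit_shift_itv u01) tuD.
  have -> : T t - T u = n%:R * (t - u) by rewrite /digit_shift dd'; ring.
  rewrite normrM ger0_norm// -ler_pdivlMl// => /le_trans; apply.
  rewrite mulrDr exprS invfM lerD2r ler_pdivrMl//.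
  have -> : (2 * D) `^ s = (2 * (q^-1 * D)) `^ s * q `^ s.
    rewrite -powRM ?(ltW q0)//; first by congr powR; field; rewrite gt_eqF.
    by rewrite !mulr_ge0// invr_ge0 ltW.
  by rewrite [leRHS]mulrCA ler_peMr ?powR_ge0.
(* When the first digits differ, the coordinate gap forces [2 * D >= 1]; the power term is then at
   least 1 and dominates [|t - u|]. *)
have D1 : 2^-1 <= D.
  apply: le_trans tuD.
  have tc := coding_corner (digit_shift_itv t01).
  have uc := coding_corner (digit_shift_itv u01).
  rewrite (codingE t01) (codingE u01).
  apply: le_trans (coord_le_enorm _ (Ordinal (digit_lt t01))).
  apply: le_trans (simil_coord_gap q0 q1 tc uc dd) _.
  by rewrite [X in `|X|]mxE [X in `|_ + X|]mxE; exact: ler_norm.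
have P1 : 1 <= (2 * D) `^ s.
  rewrite [leLHS](_ : 1 = 1 `^ s); last by rewrite powR1.
  apply: ge0_ler_powR => //; rewrite ?nnegrE; lra.
have e0 : 0 <= n%:R ^- m.+1 :> R by rewrite invr_ge0 exprn_ge0.
apply: (@le_trans _ _ 1); last by lra.
by rewrite ler_norml; lra.
Qed.

Lemma coding_holder_lim s t u (D : R) : 0 <= s -> 1 <= n%:R * q `^ s ->
  0 <= t < 1 -> 0 <= u < 1 -> enorm (coding n q t - coding n q u) <= D ->
  `|t - u| <= (2 * D) `^ s.
Proof.
move=> s0 ns t01 u01 tuD; apply/ler_addgt0Pr => e e0.
have nc : `|n%:R^-1 : R| < 1.
  by rewrite ger0_norm ?invr_ge0 ?ler0n// invf_lt1// ltr1n.
have /cvgrPdist_lt/(_ e e0)[m _ /(_ m (leqnn m))/=] := cvg_expr nc.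
rewrite sub0r normrN ger0_norm ?exprn_ge0 ?invr_ge0 ?ler0n// exprVn => /ltW me.
by apply: le_trans (coding_holder m s0 ns t01 u01 tuD) _; rewrite lerD2l.
Qed.

(** The parameters coded into [U] lie within [r], the [s]-th power of twice the diameter, of any one
    of them, [u]; hence an interval of length [2 * r] centred at [u]. If there is none, the empty
    set serves. *)
Lemma interval_cover s (U : set 'rV[R]_n) : 0 <= s -> 1 <= n%:R * q `^ s ->
  (ediam U <= 1%:E)%E ->
  exists J : set R, [/\ measurable J,
    (lebesgue_measure J <= (2 * 2 `^ s)%:E * diam_pow s U)%E &
    forall t, 0 <= t < 1 -> U (coding n q t) -> J t].
Proof.
move=> s0 ns U1.
have [[u u01 Uu]|nU] := pselect (exists2 u : R, 0 <= u < 1 & U (coding n q u));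
  last first.
  exists set0; split=> [//||t t01 Ut]; last by apply: nU; exists t.
  rewrite measure0 mule_ge0 ?diam_pow_ge0// lee_fin mulr_ge0// powR_ge0.
have eU := enorm_le_ediam Uu Uu.
have eU0 : (0 <= ediam U)%E.
  by apply: le_trans eU; rewrite lee_fin enorm_ge0.
have Ufin : ediam U \is a fin_num.
  by rewrite ge0_fin_numE// (le_lt_trans U1)// ltry.
pose D := fine (ediam U); have DE : ediam U = D%:E by rewrite fineK.
have D0 : 0 <= D by rewrite -lee_fin -DE.
pose r := (2 * D) `^ s; have r0 : 0 <= r := powR_ge0 _ _.
exists `[u - r, u + r]%classic; split.
- exact: measurable_itv.
- have -> : diam_pow s U = (D `^ s)%:E.
    rewrite /diam_pow ifF ?DE//; apply/negP => /eqP U0; by rewrite U0 in Uu.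
  rewrite lebesgue_measure_itv/= -EFinM -EFinD; case: ifP => _; rewrite lee_fin.
    have -> : r = 2 `^ s * D `^ s by rewrite /r powRM.
    by lra.
  by rewrite !mulr_ge0 ?powR_ge0.
- move=> t t01 Ut /=; rewrite in_itv/= -ler_distl.
  apply: (coding_holder_lim s0 ns t01 u01).
  by rewrite -lee_fin -DE; exact: enorm_le_ediam.
Qed.

(** Mass comparison: were the measure zero, some cover of [K] would have so small a sum that the
    associated sets of parameters, of total Lebesgue measure less than 1, would cover [[0, 1[]. *)
Lemma hausdorff_measure_attractor_neq0 s : 0 <= s -> 1 <= n%:R * q `^ s ->
  hausdorff_measure s K <> 0%E.
Proof.
move=> s0 ns H0.
have C0 : 0 < 2 * 2 `^ s :> R by rewrite mulr_gt0// powR_gt0.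
have : (hausdorff_content s 1 K < ((2 * 2 `^ s)^-1)%:E)%E.
  apply: (@le_lt_trans _ _ 0%E); last by rewrite lte_fin invr_gt0.
  rewrite -H0; apply: ereal_sup_ubound; exists 1 => //=; exact: ltr01.
move=> /ereal_inf_lt[_ [U [KU Ud] <-] Us].
have [J HJ] := choice (fun i => interval_cover s0 ns (Ud i)).
have : (lebesgue_measure `[0%R, 1%R[%classic <=
    \sum_(0 <= i <oo) lebesgue_measure (J i) :> \bar R)%E.
  apply: measure_sigma_subadditive => [i||t].
  - by have [] := HJ i.
  - exact: measurable_itv.
  rewrite /= in_itv/= => t01.
  have [i _ Ui] := KU _ (coding_attractor t01).
  by exists i => //; have [_ _] := HJ i; exact.
rewrite lebesgue_measure_itv/= lte_fin ltr01 -EFinB subr0; apply/negP.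
rewrite -ltNge.
apply: (@le_lt_trans _ _ (\sum_(0 <= i <oo) (2 * 2 `^ s)%:E * diam_pow s (U i))%E).
  by apply: lee_nneseries => [i _ _|i _]; [exact: measure_ge0|have [] := HJ i].
rewrite nneseriesZl; last by move=> i _; exact: diam_pow_ge0.
have -> : 1%:E = ((2 * 2 `^ s)%:E * ((2 * 2 `^ s)^-1)%:E)%E :> \bar R.
  by rewrite -EFinM mulfV// gt_eqF.
by rewrite lte_pmul2l.
Qed.

End LowerBound.

(** * The exact dimension and the choice of the ratio *)

Lemma hausdorff_dim_attractor (R : realType) (n : nat) (q : R) :
  0 < q -> q <= 4^-1 -> (2 <= n)%N ->
  hausdorff_dim (attractor n q) = ((- ln q)^-1 * ln n%:R)%:E.
Proof.
move=> q0 q1 n2; set s0 := _ * _.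
have n0 : (0 < n)%N by exact: leq_trans n2.
have lq : 0 < - ln q by rewrite oppr_gt0 ln_lt0// q0/=; lra.
have ln0 : 0 < ln n%:R :> R by rewrite ln_gt0// ltr1n.
have ss0 : 0 < s0 by rewrite mulr_gt0// invr_gt0.
have lnE : ln n%:R = s0 * - ln q by rewrite mulrAC mulVf ?mul1r// gt_eqF.
(* Comparing [n q^s] with 1 thus amounts to comparing [s0] with [s], which links the two bounds. *)
have nqE s : n%:R * q `^ s = expR ((s0 - s) * - ln q).
  rewrite /powR gt_eqF// -[X in X * _]lnK ?posrE ?ltr0n// -expRD lnE.
  by congr expR; ring.
apply/eqP; rewrite eq_le; apply/andP; split.
  apply/lee_addgt0Pr => e e0; rewrite -EFinD.
  have se0 : 0 <= s0 + e by rewrite addr_ge0// ltW.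
  apply: ereal_inf_lbound; exists (s0 + e) => //; split=> //.
  apply: hausdorff_measure_attractor_eq0 => //.
  by rewrite nqE expR_lt1 opprD addNKr mulNr oppr_lt0 mulr_gt0.
apply: le_ereal_inf_tmp => _ [s [s_ge0 Hs] <-]; rewrite lee_fin leNgt.
apply/negP => ss; apply: (hausdorff_measure_attractor_neq0 q0 q1 n2 s_ge0) Hs.
by rewrite nqE -expR0 ler_expR ltW// mulr_gt0// subr_gt0.
Qed.

Lemma attractor_near_special_angles (R : realType) (eps : R) : 0 < eps ->
  exists c : R, 0 < c /\ forall n : nat, (2 <= n)%N ->
    exists K : set 'rV[R]_n,
      [/\ compact_homothetic_self_similar K,
          hausdorff_dim K = (c * ln n%:R)%:E &
          forall theta : R, contains_angle K theta ->
            exists a : R, special_angles a /\ `|theta - a| < eps].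
Proof.
move=> e0; have [h h0 Hh] := special_angles_near e0.
(* The first bound keeps the perturbation of the roots in the admissible range, the second gives
   [32 * q < h]. Neither involves [n], so the constant depends on [eps] alone. *)
pose q : R := Num.min (64^-1 / 2) (h / 64).
have q0 : 0 < q by rewrite lt_min !divr_gt0 ?invr_gt0.
have qa : q <= 64^-1 / 2 by rewrite ge_min lexx.
have qh : q <= h / 64 by rewrite ge_min lexx orbT.
have q1 : q <= 4^-1 by lra.
exists (- ln q)^-1; split.
  by rewrite invr_gt0 oppr_gt0 ln_lt0// q0/=; lra.
move=> n n2; exists (attractor n q); split.
- by apply: attractor_self_similar => //; exact: leq_trans n2.
- exact: hausdorff_dim_attractor.
move=> _ [x [y [z [[xK yK zK] [[xy xz _] <-]]]]].
have qh' : 32 * q < h by lra.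
have [c cs] := attractor_angle q0 q1 xK yK zK xy xz qa qh'.
by apply: Hh => //; have [_] := cos_angle (y - x) (z - x).
Qed.

Theorem theorem3p4 (R : realType) :
  (forall eps : R, 0 < eps ->
     exists c : R, 0 < c /\
       forall n : nat, (2 <= n)%N ->
         exists K : set 'rV[R]_n,
           [/\ compact_homothetic_self_similar K,
               ((c * ln n%:R)%:E <= hausdorff_dim K)%E &
               forall theta : R, contains_angle K theta ->
                 exists a : R, special_angles a /\ `|theta - a| < eps])
  /\
  (forall alpha : R, 0 < alpha < pi ->
     alpha <> pi / 3 -> alpha <> pi / 2 -> alpha <> 2 * pi / 3 ->
     exists c : R, 0 < c /\
       forall n : nat, (2 <= n)%N ->
         exists K : set 'rV[R]_n,
           [/\ compact K,
               hausdorff_dim K = (c * ln n%:R)%:E,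
               ~ contains_angle K alpha &
               exists delta : R, 0 < delta /\
                 forall theta : R, `|theta - alpha| < delta ->
                   ~ contains_angle K theta]).
Proof.
split=> [eps e0|alpha /andP[a0 api] a1 a2 a3].
  have [c [c0 H]] := attractor_near_special_angles e0.
  exists c; split=> // n n2; have [K [K1 K2 K3]] := H n n2.
  by exists K; split=> //; rewrite K2.
(* The distance from [alpha] to the special angles. Half of it serves both as [eps] and as the
   radius of the excluded neighborhood, so a contained angle in it would contradict the triangle
   inequality. *)
pose d := Num.min `|alpha| (Num.min `|alpha - pi / 3| (Num.min `|alpha - pi / 2|
  (Num.min `|alpha - 2 * pi / 3| `|alpha - pi|))).
have d0 : 0 < d.
  rewrite !lt_min !normr_gt0 !subr_eq0 gt_eqF// (lt_eqF api)//=.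
  by apply/and4P; split=> //; apply/eqP.
have dP a : special_angles a -> d <= `|alpha - a|.
  by case=> [[->|->|->|->]|->]; rewrite !ge_min ?subr0 lexx ?orbT.
have e0 : 0 < d / 2 by rewrite divr_gt0.
have [c [c0 H]] := attractor_near_special_angles e0.
exists c; split=> // n n2; have [K [[_ Kc _] K2 K3]] := H n n2.
have far theta : `|theta - alpha| < d / 2 -> ~ contains_angle K theta.
  move=> ta /K3[a [/dP da tha]]; have := ler_distD theta alpha a.
  by rewrite [`|alpha - theta|]distrC; lra.
exists K; split=> //; last by exists (d / 2).
by apply: far; rewrite subrr normr0.
Qed.
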